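(* Let $a$ be a positive integer and suppose $a\,T_k(m)=(2m+1)^k$ with positive integers $k$ and $m>1$. If $a\equiv1\pmod 4$, then $\operatorname{ord}_2(am-1)=2+\operatorname{ord}_2 k$; if $a\equiv 3\pmod 4$, then $\operatorname{ord}_2(am-1)\ge 3+\operatorname{ord}_2 k$.
   Context: $T_k(m):=\sum_{j=1}^{m}(2j-1)^k$; $\operatorname{ord}_2$ denotes the $2$-adic valuation. *)

(* Defs.v *)
From mathcomp Require Import all_boot.

Set Implicit Arguments.
Unset Strict Implicit.
Unset Printing Implicit Defensive.

(* Since j >= 1 in the range, the truncated subtraction 2 * j - 1 is exact. *)
Definition T (k m : nat) : nat := \sum_(1 <= j < m.+1) (2 * j - 1) ^ k.

(* The 2-adic valuation, to be used on positive arguments only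
   (logn 2 0 = 0, whereas ord_2 0 is infinite). *)
Definition ord2 (n : nat) : nat := logn 2 n.

(* Main.v *)
Require Import Defs.
From mathcomp Require Import all_boot.
From mathcomp Require Import zify ring.

Set Implicit Arguments.
Unset Strict Implicit.
Unset Printing Implicit Defensive.

(** If [k] is odd, pairing [2 j - 1] with [2 m - (2 j - 1)] gives [m %| T k m],
    which is impossible as [m] is coprime to [2 m + 1].  If [k] is even with
    valuation [v], then [(2 y + 1) ^ 2 = 1 + 8 'C(y + 1, 2)] yields
    [(2 y + 1) ^ k = 1 + 2 ^ (v + 2) 'C(y + 1, 2)] modulo [2 ^ (v + 3)].
    Summing over [y < m],
    [a (m + 2 ^ (v + 2) 'C(m + 1, 3)) = 1 + 2 ^ (v + 2) 'C(m + 1, 2)] modulo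
    [2 ^ (v + 3)].  Since [m] is odd, ['C(m + 1, 3)] is even, so the valuation of
    [a m - 1] is decided by the parity of ['C(m + 1, 2)], that is by
    [m] modulo [4], which equals [a] modulo [4]. *)

Lemma T_ord k m : T k m = \sum_(y < m) (2 * y + 1) ^ k.
Proof.
rewrite /T big_add1 big_mkord; apply: eq_bigr => y _.
by rewrite mulnS add2n subn1 addn1.
Qed.

Lemma T_recr k m : T k m.+1 = T k m + (2 * m + 1) ^ k.
Proof. by rewrite !T_ord big_ord_recr. Qed.

Lemma odd_T k m : odd (T k m) = odd m.
Proof.
elim: m => [|m IH]; first by rewrite T_ord big_ord0.
rewrite T_recr oddD IH oddX oddD oddM /= orbT.
by case: (odd m).
Qed.

Lemma dvdn_add_odd_pow x y k : odd k -> x + y %| x ^ k + y ^ k.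
Proof.
move=> k_odd; rewrite -(odd_double_half k) k_odd.
elim: (k./2) => [|h IH]; first by rewrite !expn1.
rewrite doubleS addnS addnS; set n := _ + h.*2 in IH *.
rewrite -(dvdn_addl _ (dvdn_mull (x * y) IH)).
suff -> : x ^ n.+2 + y ^ n.+2 + x * y * (x ^ n + y ^ n)
          = (x + y) * (x ^ n.+1 + y ^ n.+1) by apply: dvdn_mulr.
by rewrite !expnS; ring.
Qed.

Lemma dvdn_T_odd k m : odd k -> m %| T k m.
Proof.
move=> k_odd; have [->|m_gt0] := posnP m; first by rewrite T_ord big_ord0.
(* Doubling allows the sum to be added to its own reversal. *)
suff: m * 2 %| T k m * 2 by rewrite dvdn_pmul2r.
rewrite [T k m * 2]muln2 -addnn {2}T_ord (reindex_inj rev_ord_inj) /= T_ord.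
rewrite -big_split /=; apply: dvdn_sum => y _.
suff -> : m * 2 = (2 * y + 1) + (2 * (m - y.+1) + 1) by exact: dvdn_add_odd_pow.
by have := ltn_ord y; lia.
Qed.

(** Repeated squaring: [(1 + 2 * B * c) ^ 2 = 1 + 4 * B * (c + B * c ^ 2)], where [B = 2 ^ (w + 2)]
    is even. The term [2 * s] encodes a congruence modulo [2 ^ (w + 4)]. *)
Lemma exp_pow2_expansion t w :
  exists s, (1 + 8 * t) ^ (2 ^ w) = 1 + 2 ^ (w + 3) * (t + 2 * s).
Proof.
elim: w => [|w [s IH]]; first by exists 0; rewrite expn1; lia.
rewrite expnSr expnM IH -[w.+1]add1n !expnD.
by exists (s + 2 ^ w * 2 * (t + 2 * s) ^ 2); ring.
Qed.

(** For even [A] the square of [1 + A * t] is 1 modulo [2 * A], so only the parity of the exponent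
    matters. *)
Lemma exp_odd_expansion A t u : ~~ odd A -> odd u ->
  exists s, (1 + A * t) ^ u = 1 + A * (t + 2 * s).
Proof.
move=> A_even u_odd; rewrite -(odd_double_half u) u_odd.
have -> : A = 2 * A./2 by have := odd_double_half A; lia.
elim: (u./2) => [|h [s IH]]; first by exists 0; rewrite expn1; ring.
rewrite doubleS !addnS 2!expnS IH; set B := A./2.
exists (s + (t + B * t * t) * (1 + 2 * B * (t + 2 * s))); ring.
Qed.

Lemma odd_exp_expansion k y : 0 < k -> ~~ odd k ->
  exists s, (2 * y + 1) ^ k = 1 + 2 ^ (logn 2 k + 2) * ('C(y.+1, 2) + 2 * s).
Proof.
move=> k_gt0 k_even.
have [u] := pfactor_coprime (isT : prime 2) k_gt0; rewrite coprime2n => u_odd ->.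
have : 0 < logn 2 k by rewrite logn_gt0 mem_primes k_gt0 dvdn2.
(* One factor 2 of [k] is spent on the first square, which supplies the 8; [w] squarings and the odd
   power [u] remain. *)
case: (logn 2 k) => // w _.
have sq : (2 * y + 1) ^ 2 = 1 + 8 * 'C(y.+1, 2).
  have := mul_bin_diag y.+1 1; rewrite bin1 expnS expn1; nia.
rewrite lognM ?expn_gt0 ?(odd_gt0 u_odd) // pfactorK // lognE dvdn2 u_odd !andbF /=.
rewrite [u * _]mulnC expnM [2 ^ w.+1]expnS expnM sq.
have [s1 ->] := exp_pow2_expansion 'C(y.+1, 2) w.
have [|s2 ->] := exp_odd_expansion ('C(y.+1, 2) + 2 * s1) _ u_odd (A := 2 ^ (w + 3)).
  by rewrite oddX addnS.
have -> : 0 + w.+1 + 2 = w + 3 by lia.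
by exists (s1 + s2); ring.
Qed.

Lemma T_expansion k m : 0 < k -> ~~ odd k ->
  exists s, T k m = m + 2 ^ (logn 2 k + 2) * ('C(m.+1, 3) + 2 * s).
Proof.
move=> k_gt0 k_even; elim: m => [|m [s IH]].
  by exists 0; rewrite T_ord big_ord0 bin_small ?muln0.
have [s' E] := odd_exp_expansion m k_gt0 k_even.
(* Pascal's rule absorbs ['C(m.+1, 2)] into ['C(m.+2, 3)]. *)
by exists (s + s'); rewrite T_recr IH E [in RHS]binS; ring.
Qed.

Lemma even_bin3 m : odd m -> ~~ odd 'C(m.+1, 3).
Proof.
move=> m_odd; have [q ->] : exists q, m = 2 * q + 1 by exists m./2; lia.
have := mul_bin_diag (2 * q + 1).+1 2; have := mul_bin_left (2 * q + 1) 1.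
rewrite bin1 /= => E2 E3; apply/negP => c_odd.
have E2' : 'C(2 * q + 1, 2) = q * (2 * q + 1) by nia.
(* The factor 3 is odd, so the binomial takes the parity of the right-hand side. *)
have : 3 * 'C((2 * q + 1).+1, 3) = 2 * ((q + 1) * (q * (2 * q + 1))).
  by rewrite -E3 E2'; ring.
by move/(congr1 odd); rewrite !oddM c_odd.
Qed.

Lemma odd_bin2 m : odd m -> odd 'C(m.+1, 2) = (m %% 4 == 1).
Proof.
move=> m_odd; have := mul_bin_diag m.+1 1; rewrite bin1.
by move: m_odd; case: eqP => /=; nia.
Qed.

Theorem theorem4 (a k m : nat) (ha : 0 < a) (hk : 0 < k) (hm : 1 < m)
    (heq : a * T k m = (2 * m + 1) ^ k) :
  (a = 1 %[mod 4] -> ord2 (a * m - 1) = 2 + ord2 k) /\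
  (a = 3 %[mod 4] -> 3 + ord2 k <= ord2 (a * m - 1)).
Proof.
have /andP[a_odd m_odd] : odd a && odd m.
  by rewrite -(odd_T k m) -oddM heq oddX oddD oddM orbT.
have k_even : ~~ odd k.
  apply/negP => /(dvdn_T_odd m) /(dvdn_mull a); rewrite heq => m_dvd.
  have : coprime m ((2 * m + 1) ^ k).
    by rewrite coprimeXr // /coprime gcdnMDl gcdn1.
  by rewrite /coprime (gcdn_idPl m_dvd); lia.
have [s ET] := T_expansion m hk k_even.
have [s' EX] := odd_exp_expansion m hk k_even.
move: heq (even_bin3 m_odd) (odd_bin2 m_odd); rewrite {}ET {}EX /ord2.
move: (logn 2 k) 'C(_, 3) 'C(_, 2) => v c3 c2 heq c3_even c2_odd.
have am_gt1 : 1 < a * m := leq_trans hm (leq_pmull m ha).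
(* Cancelling 1 and then [2 ^ (v + 2)] leaves [a * (c3 + 2 * s) + d = c2 + 2 * s'], so [d] has the
   parity of [c2]. *)
have [d Ed odd_d] : exists2 d, a * m - 1 = 2 ^ (v + 2) * d & odd d = (m %% 4 == 1).
  have E : 2 ^ (v + 2) * (a * (c3 + 2 * s)) + (a * m - 1)
           = 2 ^ (v + 2) * (c2 + 2 * s').
    by apply: (@addnI 1); rewrite -heq mulnDr [a * (_ * _)]mulnCA; lia.
  have : 2 ^ (v + 2) %| a * m - 1.
    by rewrite -(dvdn_addr _ (dvdn_mulr (a * (c3 + 2 * s)) (dvdnn _))) E dvdn_mulr.
  case/dvdnP=> d; rewrite [d * _]mulnC => Ed; exists d => //.
  move: E; rewrite Ed -mulnDr => /eqP; rewrite eqn_pmul2l ?expn_gt0 // => /eqP.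
  by move/(congr1 odd); rewrite !(oddD, oddM) (negPf c3_even) a_odd /= addbF => ->.
have d_gt0 : 0 < d by move: Ed; case: d {odd_d} => //; rewrite muln0; lia.
(* An odd residue modulo 4 is its own inverse, hence [a] and [m] agree modulo 4. *)
have am_mod4 : (a * m) %% 4 = 1.
  have -> : a * m = 2 ^ v * d * 4 + 1.
    by move: Ed; rewrite expnD; lia.
  by rewrite modnMDl.
have a_mod4 : a %% 4 = m %% 4.
  have odd_mod4 n : odd n -> n %% 4 = 1 \/ n %% 4 = 3 by lia.
  move: am_mod4; rewrite -modnMm.
  by case: (odd_mod4 a a_odd) (odd_mod4 m m_odd) => -> [] ->.
rewrite Ed lognM ?expn_gt0 // pfactorK // a_mod4; split=> m_mod4.
  have -> : logn 2 d = 0 by rewrite lognE dvdn2 odd_d m_mod4 !andbF.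
  by rewrite addn0 addnC.
have : 0 < logn 2 d by rewrite logn_gt0 mem_primes d_gt0 dvdn2 odd_d m_mod4.
lia.
Qed.
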